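(* Let $M=M[U,L]$ be a connected lattice path matroid of rank $r$ on $r+m$ elements, with $\mathrm{st}(L)=(L_1,\dots,L_{r+m})$ and $\mathrm{st}(U)=(U_1,\dots,U_{r+m})$. Then there exists a bijective affine transformation taking $P_M\subset\mathbb{R}^{r+m}$ onto a full-dimensional distributive integer polytope $Q_M\subset\mathbb{R}^{r+m-1}$, where $Q_M$ consists of all $q\in\mathbb{R}^{r+m-1}$ such that $$0\leq (-1)^{L_{i+1}}(q_{i+1}-q_i)\leq 1 \quad\text{for all } i\in\{1,\dots,r+m-2\}$$ and $$0\leq q_i\leq \sum_{j=1}^i(U_j-L_j)\quad\text{for all } i\in\{1,\dots,r+m-1\}.$$ Moreover, $L_{P_M}(t)=L_{Q_M}(t)$.
   Context: A lattice path from $(0,0)$ to $(m,r)$ uses unit steps $(1,0)$ and $(0,1)$; its step vector $\mathrm{st}(P)\in\{0,1\}^{r+m}$ lists the $y$-changes of its steps. For lattice paths $U,L$ from $(0,0)$ to $(m,r)$ with $L$ never above $U$, $M[U,L]$ is the matroid on $\{1,\dots,r+m\}$ whose bases are the sets $\{i:P_i=1\}$ for lattice paths $P$ never above $U$ and never below $L$; it is connected iff $U$ and $L$ meet only at $(0,0)$ and $(m,r)$. $P_M=\mathrm{conv}\{\sum_{i\in B}e_i:B\text{ a basis}\}$. A polytope $Q\subseteq\mathbb{R}^n$ is distributive if for all $x,y\in Q$ the componentwise maximum and minimum of $x,y$ lie in $Q$. For a polytope $P\subseteq\mathbb{R}^n$, $L_P(t)=\#(tP\cap\mathbb{Z}^n)$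 for integers $t\ge0$. *)

(* Defs.v *)
From mathcomp Require Export all_boot all_order all_algebra.
From mathcomp Require Export finmap boolp classical_sets functions cardinality.
From mathcomp Require Export reals.

Set Implicit Arguments.
Unset Strict Implicit.
Unset Printing Implicit Defensive.

Export Order.TTheory GRing.Theory Num.Theory.

Local Open Scope classical_set_scope.
Local Open Scope ring_scope.

(* A lattice path from (0,0) to (m,r) is represented by its step vector.      *)
(* Coordinates are numbered from 0: P_i of the 1-based convention is          *)
(* [nth false P i.-1].                                                        *)

Definition lattice_path (r m : nat) (P : (r + m).-tuple bool) : bool :=
  count id P == r.

(* The y-coordinate after k steps. *)
Definition height (n : nat) (P : n.-tuple bool) (k : nat) : nat :=
  count id (take k P).

(* After k steps every path is on the antidiagonal x + y = k, so two paths    *)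
(* are compared by comparing their heights after the same number of steps.    *)
Definition never_above (n : nat) (P Q : n.-tuple bool) : bool :=
  [forall k : 'I_n.+1, (height P k <= height Q k)%N].

Definition lpm_bases (r m : nat) (U L : (r + m).-tuple bool) :
    {set {set 'I_(r + m)}} :=
  [set [set i | tnth P i] | P : (r + m).-tuple bool
     & [&& lattice_path P, never_above P U & never_above L P]]%SET.

(* Matroids on 'I_n are given by their set of bases. *)

Definition indep (n : nat) (BB : {set {set 'I_n}}) (I : {set 'I_n}) : bool :=
  [exists B in BB, I \subset B].

Definition circuit (n : nat) (BB : {set {set 'I_n}}) (C : {set 'I_n}) : bool :=
  minset (fun D => ~~ indep BB D) C.

(* Any two distinct elements lie in a common circuit; equivalently, the       *)
(* matroid is not a direct sum of two matroids on nonempty ground sets.       *)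
Definition connected_matroid (n : nat) (BB : {set {set 'I_n}}) : Prop :=
  forall i j : 'I_n, i != j ->
    exists C : {set 'I_n}, [/\ circuit BB C, i \in C & j \in C].

Definition conv_hull (R : realType) (n : nat) (A : set 'rV[R]_n) :
    set 'rV[R]_n :=
  [set x | exists (k : nat) (a : 'I_k -> R) (v : 'I_k -> 'rV[R]_n),
     [/\ forall i, A (v i), forall i, 0 <= a i,
         \sum_i a i = 1 & x = \sum_i a i *: v i]].

Definition affine_hull (R : realType) (n : nat) (A : set 'rV[R]_n) :
    set 'rV[R]_n :=
  [set x | exists (k : nat) (a : 'I_k -> R) (v : 'I_k -> 'rV[R]_n),
     [/\ forall i, A (v i), \sum_i a i = 1 & x = \sum_i a i *: v i]].

Definition affine_map (R : realType) (n p : nat) (f : 'rV[R]_n -> 'rV[R]_p) :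
    Prop :=
  exists (A : 'M[R]_(n, p)) (b : 'rV[R]_p), forall x, f x = x *m A + b.

(* A bijective affine transformation taking P onto Q is one between their     *)
(* affine hulls, so that P and Q may live in spaces of different dimension.   *)
Definition affine_bij_onto (R : realType) (n p : nat)
    (P : set 'rV[R]_n) (Q : set 'rV[R]_p) : Prop :=
  exists f : 'rV[R]_n -> 'rV[R]_p,
    [/\ affine_map f, set_bij (affine_hull P) (affine_hull Q) f & f @` P = Q].

Definition polytope (R : realType) (n : nat) (Q : set 'rV[R]_n) : Prop :=
  exists s : seq 'rV[R]_n, Q = conv_hull [set` s].

(* For a polytope, the vertices are the extreme points. *)
Definition vertex (R : realType) (n : nat) (Q : set 'rV[R]_n) (x : 'rV[R]_n) :
    Prop :=
  Q x /\ forall (y z : 'rV[R]_n) (a : R), Q y -> Q z -> 0 < a < 1 ->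
    x = a *: y + (1 - a) *: z -> y = z.

Definition int_points (R : realType) (n : nat) : set 'rV[R]_n :=
  [set x : 'rV[R]_n | forall i, x 0 i \is a Num.int].

Arguments int_points R n _ : clear implicits.

Definition integer_polytope (R : realType) (n : nat) (Q : set 'rV[R]_n) :
    Prop :=
  polytope Q /\ forall x, vertex Q x -> int_points R n x.

Definition full_dimensional (R : realType) (n : nat) (Q : set 'rV[R]_n) :
    Prop :=
  affine_hull Q = setT.

Definition distributive (R : realType) (n : nat) (Q : set 'rV[R]_n) : Prop :=
  forall x y, Q x -> Q y ->
    Q (\row_i Num.max (x 0 i) (y 0 i)) /\ Q (\row_i Num.min (x 0 i) (y 0 i)).

(* [fset_set] is meaningful on finite sets only; the lattice points of a      *)
(* dilated polytope form a finite set.                                        *)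
Definition ehrhart (R : realType) (n : nat) (P : set 'rV[R]_n) (t : nat) : nat :=
  #|` @fset_set 'rV[R]_n ([set t%:R *: x | x in P] `&` int_points R n)|.

Definition matroid_polytope (R : realType) (n : nat) (BB : {set {set 'I_n}}) :
    set 'rV[R]_n :=
  conv_hull [set x | exists2 B, B \in BB & x = \sum_(i in B) delta_mx 0 i].

Arguments matroid_polytope R {n} BB _.

(* [q 0 i] is the 1-based coordinate q_(i+1), so that the pair (q_i, q_(i+1)) *)
(* with sign exponent L_(i+1) becomes (q 0 i, q 0 j) with j = i + 1 and       *)
(* exponent [nth false L j].                                                  *)
Definition lpm_polytope (R : realType) (r m : nat) (U L : (r + m).-tuple bool) :
    set 'rV[R]_((r + m).-1) :=
  [set q : 'rV[R]_((r + m).-1) |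
        (forall i j : 'I_((r + m).-1), j = i.+1 :> nat ->
              0 <= (-1) ^+ nth false L j * (q 0 j - q 0 i) <= 1)
        /\ (forall i : 'I_((r + m).-1),
              0 <= q 0 i <=
                \sum_(j < i.+1) ((nth false U j)%:R - (nth false L j)%:R))].

Arguments lpm_polytope R {r m} U L _.

(* Main.v *)
Require Import Defs.
From mathcomp Require Import lra zify.

(* The affine map sends x to the vector of its first r + m - 1 partial sums,
   minus those of st(L). Only the inclusion of Q_M in the image needs an idea: a
   point of Q_M is a fractional lattice path, given by real heights with
   increments in [0, 1] between those of L and U. Taking the ceiling of all
   heights after a common shift by t in [0, 1) yields an honest lattice path
   between L and U, and the average over t is the fractional path. Connectedness
   is used only for full-dimensionality. *)

Set Implicit Arguments.
Unset Strict Implicit.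
Unset Printing Implicit Defensive.

Local Open Scope classical_set_scope.
Local Open Scope ring_scope.

(** * Heights of lattice paths, and bases as paths *)

Lemma height0 (n : nat) (P : n.-tuple bool) : height P 0 = 0%N.
Proof. by rewrite /height take0. Qed.

Lemma heightS (n : nat) (P : n.-tuple bool) (i : 'I_n) :
  height P i.+1 = (height P i + tnth P i)%N.
Proof.
rewrite /height (take_nth false) ?size_tuple // -cats1 count_cat /= addn0.
by rewrite (tnth_nth false).
Qed.

Lemma heightS_nth (n : nat) (P : n.-tuple bool) (k : nat) : (k < n)%N ->
  height P k.+1 = (height P k + nth false P k)%N.
Proof. by move=> kn; rewrite (heightS P (Ordinal kn)) (tnth_nth false). Qed.

Lemma height_full (n : nat) (P : n.-tuple bool) : height P n = count id P.
Proof. by rewrite /height take_oversize // size_tuple. Qed.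

Lemma height_leq (n : nat) (P : n.-tuple bool) (k : nat) : (height P k <= k)%N.
Proof.
by rewrite /height (leq_trans (count_size _ _)) // size_take_min geq_minl.
Qed.

Lemma never_aboveP (n : nat) (P Q : n.-tuple bool) :
  reflect (forall k, (k <= n)%N -> (height P k <= height Q k)%N)
          (never_above P Q).
Proof.
apply: (iffP forallP) => [h k kn | h k]; last by apply: h; rewrite -ltnS.
by have := h (Ordinal (kn : (k < n.+1)%N)).
Qed.

Lemma lpm_basesP (r m : nat) (U L : (r + m).-tuple bool) (B : {set 'I_(r + m)}) :
  reflect (exists2 P : (r + m).-tuple bool,
             [/\ lattice_path P, never_above P U & never_above L P]
             & B = [set i | tnth P i]%SET)
          (B \in lpm_bases U L).
Proof.
apply: (iffP imsetP) => [[P]|[P [h1 h2 h3] ->]]; last first.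
  by exists P; rewrite // inE h1 h2 h3.
by rewrite inE => /and3P[h1 h2 h3] ->; exists P.
Qed.

(** * Gluing of two paths, and connectedness *)

Section Glue.
Variables (n : nat) (P Q : n.-tuple bool) (k : nat).

Definition glue : n.-tuple bool :=
  [tuple if (i < k)%N then tnth P i else tnth Q i | i < n].

Hypothesis meet : height P k = height Q k.

Lemma height_glue_l (j : nat) : (j <= n)%N -> (j <= k)%N ->
  height glue j = height P j.
Proof.
elim: j => [|j IH] jn jk; first by rewrite !height0.
rewrite -[j]/(nat_of_ord (Ordinal jn)) !heightS /= IH ?(ltnW jn) ?(ltnW jk) //.
by rewrite tnth_mktuple /= jk.
Qed.

Lemma height_glue_r (j : nat) : (j <= n)%N -> (k <= j)%N ->
  height glue j = height Q j.
Proof.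
elim: j => [|j IH] jn; first by rewrite !height0.
rewrite leq_eqVlt => /predU1P[kj|kj].
  by rewrite -kj -meet height_glue_l // kj.
rewrite -[j]/(nat_of_ord (Ordinal jn)) !heightS /= IH ?(ltnW jn) //.
by rewrite tnth_mktuple /= ltnNge -ltnS kj.
Qed.

(** In this form any bound shared by both paths, such as lying between [L] and [U], passes to the
    glued path. *)
Lemma height_glue (j : nat) : (j <= n)%N ->
  height glue j = height P j \/ height glue j = height Q j.
Proof.
move=> jn; have [jk|kj] := leqP j k.
- by left; rewrite height_glue_l.
- by right; rewrite height_glue_r // ltnW.
Qed.

End Glue.

(* If U and L met after k steps, every basis would have the same number of
   elements before k; a circuit meeting both sides of k would then be contained
   in the basis glued from bases containing its two (independent) parts. *)
Lemma connected_lpm_apart (r m : nat) (U L : (r + m).-tuple bool) :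
  lattice_path U -> never_above L U -> connected_matroid (lpm_bases U L) ->
  forall k, (0 < k < r + m)%N -> (height L k < height U k)%N.
Proof.
move=> hU /never_aboveP hLU hM [//|k] /= kn.
rewrite ltnNge; apply/negP => ULk.
have kn' := ltnW kn.
(* The supposed meeting point comes after k + 1 steps: [i] is the last step before it and [j] the
   first one after it. *)
pose i := Ordinal kn'; pose j := Ordinal kn.
have [|C [/minsetP[/= depC minC] iC jC]] := hM i j.
  by rewrite -val_eqE /= neq_ltn ltnSn.
pose D := [set x : 'I_(r + m) | (x < k.+1)%N]%SET.
(* [C :&: E] misses [y], so it is a proper subset of the circuit; by minimality it is independent
   and lies in a basis. *)
have part (E : {set 'I_(r + m)}) y : y \in C -> y \notin E ->
    exists2 P : (r + m).-tuple bool,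
      [/\ lattice_path P, never_above P U & never_above L P]
      & forall x, x \in C -> x \in E -> tnth P x.
  move=> yC yE.
  have : indep (lpm_bases U L) (C :&: E).
    apply: contraT => /minC /(_ (finset.subsetIl _ _)) CE.
    by move: yC; rewrite -CE inE (negbTE yE) andbF.
  case/exists_inP => B /lpm_basesP[P hP ->] /fintype.subsetP sub.
  by exists P => // x xC xE; have := sub x; rewrite !inE xC xE; apply.
have [||P1 [P1r /never_aboveP P1U /never_aboveP P1L] C1] := part D j => //.
  by rewrite inE ltnn.
have [||P2 [P2r /never_aboveP P2U /never_aboveP P2L] C2] := part (~: D)%SET i => //.
  by rewrite !inE negbK /= ltnSn.
have meet : height P1 k.+1 = height P2 k.+1.
  have := P1U _ kn'; have := P1L _ kn'; have := P2U _ kn'; have := P2L _ kn'.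
  by have := hLU _ kn'; lia.
move/negP: depC; apply; apply/exists_inP.
exists [set x | tnth (glue P1 P2 k.+1) x]%SET; last first.
  apply/fintype.subsetP => x xC; rewrite inE tnth_mktuple.
  by case: ifP => xk; [apply: C1 | apply: C2]; rewrite // !inE xk.
apply/lpm_basesP; exists (glue P1 P2 k.+1) => //; split.
- rewrite /lattice_path -height_full height_glue_r // ?(ltnW kn) //.
  by rewrite height_full.
- apply/never_aboveP => l ln.
  by have [->|->] := height_glue meet ln; [apply: P1U|apply: P2U].
- apply/never_aboveP => l ln.
  by have [->|->] := height_glue meet ln; [apply: P1L|apply: P2L].
Qed.

(** * Convex and affine combinations *)

Section Convexity.
Variable R : realType.

(** The weights sum to 1, so the translation vector is reproduced exactly once. This serves convex
    and affine hulls alike. *)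
Lemma affine_map_comb (n p k : nat) (f : 'rV[R]_n -> 'rV[R]_p)
    (a : 'I_k -> R) (v : 'I_k -> 'rV[R]_n) :
  affine_map f -> \sum_i a i = 1 ->
  f (\sum_i a i *: v i) = \sum_i a i *: f (v i).
Proof.
move=> [A [b fE]] a1; rewrite fE mulmx_suml.
under [RHS]eq_bigr do rewrite fE scalerDr.
rewrite big_split /= -scaler_suml a1 scale1r; congr (_ + _).
by apply: eq_bigr => i _; rewrite scalemxAl.
Qed.

Lemma conv_hull_comb_bounds (k : nat) (a v : 'I_k -> R) (lo hi : R) :
  (forall i, 0 <= a i) -> \sum_i a i = 1 -> (forall i, lo <= v i <= hi) ->
  lo <= \sum_i a i * v i <= hi.
Proof.
move=> a0 a1 hv; rewrite -[lo]mul1r -[hi]mul1r -a1 !mulr_suml.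
by apply/andP; split; apply: ler_sum => i _;
  have /andP[? ?] := hv i; apply: ler_wpM2l.
Qed.

Lemma subset_conv_hull (n : nat) (A : set 'rV[R]_n) : A `<=` conv_hull A.
Proof.
move=> x Ax; exists 1%N, (fun=> 1), (fun=> x).
by split=> //; rewrite big_ord1 ?scale1r.
Qed.

Lemma conv_hull_image (n p : nat) (f : 'rV[R]_n -> 'rV[R]_p)
    (A : set 'rV[R]_n) :
  affine_map f -> f @` conv_hull A = conv_hull (f @` A).
Proof.
move=> aff; apply/seteqP; split=> [_ [_ [k [a [v [Av a0 a1 ->]]]] <-]|y].
  exists k, a, (f \o v); split=> // [i|]; first by exists (v i).
  exact: affine_map_comb.
move=> [k [a [v [fAv a0 a1 ->]]]].
have /choice[u hu] : forall i, exists u, A u /\ f u = v i.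
  by move=> i; have [u Au fu] := fAv i; exists u.
exists (\sum_i a i *: u i).
  by exists k, a, u; split=> // i; have [] := hu i.
rewrite affine_map_comb //; apply: eq_bigr => i _.
by have [_ ->] := hu i.
Qed.

(** Pick a point [v i] of positive weight. If the weight is 1, then x = [v i]. Otherwise x lies
    strictly between [v i] and the renormalized average [z] of the other points, and extremality
    makes the two coincide with x. *)
Lemma vertex_conv_hull (n : nat) (A : set 'rV[R]_n) (x : 'rV[R]_n) :
  vertex (conv_hull A) x -> A x.
Proof.
move=> [[k [a [v [Av a0 a1 xE]]]] ext].
have [i ai] : exists i, 0 < a i.
  apply: contrapT => noi; have /eqP : \sum_i a i = 0.
    apply: big1 => i _; apply/eqP; rewrite eq_le a0 andbT leNgt.
    by apply/negP => ai; apply: noi; exists i.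
  by rewrite a1 oner_eq0.
have rest : \sum_(j | j != i) a j = 1 - a i.
  by apply/esym/eqP; rewrite subr_eq -a1 (bigD1 i) //= addrC.
rewrite (bigD1 i) //= in xE.
have [ai1|ai1] := eqVneq (a i) 1.
  have a_eq0 j : j != i -> a j = 0.
    by move: j; apply: psumr_eq0P => // ; rewrite rest ai1 subrr.
  rewrite xE ai1 scale1r big1 ?addr0 // => j ji.
  by rewrite a_eq0 ?scale0r.
have ai_lt1 : a i < 1.
  by rewrite lt_neqAle ai1 -subr_ge0 -rest sumr_ge0.
have b0 : 1 - a i != 0 by rewrite subr_eq0 eq_sym.
pose z := \sum_(j | j != i) (a j / (1 - a i)) *: v j.
have xz : x = a i *: v i + (1 - a i) *: z.
  rewrite xE scaler_sumr; congr (_ + _); apply: eq_bigr => j _.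
  by rewrite scalerA mulrC divfK.
have conv_z : conv_hull A z.
  exists k, (fun j => if j == i then 0 else a j / (1 - a i)), v; split=> //.
  - by move=> j; case: ifP => // _; rewrite divr_ge0 // subr_ge0 ltW.
  - rewrite (bigD1 i) //= eqxx add0r; apply: etrans (divff b0).
    rewrite -[in RHS]rest mulr_suml -rest.
    by apply: eq_bigr => j /negbTE ->.
  - rewrite [RHS](bigD1 i) //= eqxx scale0r add0r.
    by apply: eq_bigr => j /negbTE ->.
have viz := ext _ _ _ (subset_conv_hull (Av i)) conv_z _ xz.
by rewrite xz -viz ?ai // -scalerDl addrC subrK scale1r; apply: Av.
Qed.

Lemma polytope_conv_hull (n : nat) (I : finType) (P : pred I)
    (v : I -> 'rV[R]_n) :
  polytope (conv_hull [set x | exists2 i, P i & x = v i]).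
Proof.
exists [seq v i | i <- enum P]; congr conv_hull; apply/seteqP; split=> x /=.
  by move=> [i Pi ->]; apply: map_f; rewrite mem_enum.
by move=> /mapP[i]; rewrite mem_enum => Pi ->; exists i.
Qed.

(** These points span affinely: y has coefficient (y_i - p_i) / d on p + d e_i, and the remaining
    weight goes to p, which takes the index [ord0]. *)
Lemma affine_hull_simplex (n : nat) (Q : set 'rV[R]_n) (p : 'rV[R]_n) (d : R) :
  d != 0 -> Q p -> (forall i, Q (p + d *: delta_mx 0 i)) ->
  full_dimensional Q.
Proof.
move=> d0 Qp Qd; apply/seteqP; split=> // y _.
pose c i := (y - p) 0 i / d.
exists n.+1, (fun j => if unlift ord0 j is Some i then c i else 1 - \sum_i c i),
  (fun j => if unlift ord0 j is Some i then p + d *: delta_mx 0 i else p).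
split.
- by move=> j; case: unliftP.
- rewrite big_ord_recl unlift_none; under [X in _ + X]eq_bigr do rewrite liftK.
  by rewrite subrK.
- rewrite big_ord_recl unlift_none.
  under [X in _ + X]eq_bigr do rewrite liftK scalerDr.
  rewrite big_split /= -scaler_suml addrA -scalerDl subrK scale1r.
  rewrite -[LHS](subrK p) addrC; congr (_ + _); rewrite [LHS]row_sum_delta.
  by apply: eq_bigr => i _; rewrite scalerA divfK.
Qed.

End Convexity.

(** * Counting by bijections, and rounding by thresholds *)

(** If [A] is infinite then so is [B], and [fset_set] takes its default value on both; hence lattice
    points can be compared without a finiteness proof. *)
Lemma card_fset_set_bij (S T : choiceType) (A : set S) (B : set T)
    (f : S -> T) (g : T -> S) :
  (forall x, A x -> B (f x) /\ g (f x) = x) ->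
  (forall y, B y -> A (g y) /\ f (g y) = y) ->
  #|` fset_set A| = #|` fset_set B|.
Proof.
move=> AB BA.
have fA : B = f @` A.
  apply/seteqP; split=> [y /BA[? ?]|_ [x /AB[? _] <-] //]; by exists (g y).
have gB : A = g @` B.
  apply/seteqP; split=> [x /AB[? ?]|_ [x /BA[? _] <-] //]; by exists (f x).
have [finA|infA] := pselect (finite_set A).
  rewrite fA fset_set_image //; apply/esym/eqP/card_in_imfsetP => x y.
  rewrite !in_fset_set // !inE => /AB[_ {2}<-] /AB[_ {2}<-] ->; by [].
have infB : ~ finite_set B.
  by move=> finB; apply: infA; rewrite gB; apply: finite_image.
by rewrite /fset_set; case: pselect => //; case: pselect.
Qed.

(* The thresholds are the consecutive values of the list, weighted by the gaps
   between them; this discretizes v = \int_0^1 [t < v] dt. *)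
Lemma threshold_decomposition (R : realType) (vs : seq R) :
  (forall v, v \in vs -> 0 <= v < 1) ->
  exists (k : nat) (a t : 'I_k -> R),
    [/\ forall i, 0 <= a i, \sum_i a i = 1, forall i, 0 <= t i < 1
      & forall v, v \in vs -> v = \sum_i a i * (t i < v)%R%:R].
Proof.
(* Adjoining 0 and 1 makes the gaps sum to 1. *)
move=> vs01; pose s := sort <=%R (0 :: vs); pose s1 := rcons s 1.
have sz : size s = (size vs).+1 by rewrite size_sort.
have s01 v : v \in s -> 0 <= v < 1.
  rewrite mem_sort inE => /predU1P[->|/vs01 //]; by rewrite lexx ltr01.
have s1_sorted : sorted <=%R s1.
  rewrite /s1; have : sorted <=%R s by exact: sort_le_sorted.
  case: (s) s01 => //= x u u01 xu; rewrite rcons_path xu /=.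
  by have /andP[_ /ltW ->] := u01 _ (mem_last x u).
have sz1 : size s1 = (size s).+1 by rewrite size_rcons.
have homo i j : (i <= j <= size s)%N -> nth 0 s1 i <= nth 0 s1 j.
  move=> /andP[ij js]; apply: le_sorted_leq_nth => //; rewrite inE sz1 ltnS //.
  exact: leq_trans ij js.
have s1E i : (i < size s)%N -> nth 0 s1 i \in s.
  by move=> si; rewrite nth_rcons si mem_nth.
have first : nth 0 s1 0 = 0.
  have /(nthP 0)[i si i0] : 0 \in s by rewrite mem_sort mem_head.
  apply/eqP; rewrite eq_le; apply/andP; split; last first.
    have s0 : (0 < size s)%N by rewrite sz.
    by have /andP[] := s01 _ (s1E _ s0).
  have : nth 0 s1 0 <= nth 0 s1 i by apply: homo; rewrite /= ltnW.
  by rewrite [nth 0 s1 i]nth_rcons si i0.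
have last : nth 0 s1 (size s) = 1 by rewrite nth_rcons ltnn eqxx.
exists (size s), (fun i => nth 0 s1 i.+1 - nth 0 s1 i), (fun i => nth 0 s1 i).
split.
- by move=> i; rewrite subr_ge0 homo // leqnSn ltn_ord.
- rewrite -(big_mkord xpredT (fun i => nth 0 s1 i.+1 - nth 0 s1 i)).
  by rewrite telescope_sumr // last first subr0.
- by move=> i; apply/s01/s1E.
move=> v vvs; have /andP[v0 v1] := vs01 _ vvs.
have /(nthP 0)[m ms mv] : v \in s by rewrite mem_sort inE vvs orbT.
have s1m : nth 0 s1 m = v by rewrite nth_rcons ms.
rewrite -(big_mkord xpredT
  (fun i => (nth 0 s1 i.+1 - nth 0 s1 i) * (nth 0 s1 i < v)%R%:R)).
(* Each term is an increment of min(s_i, v): the full gap while s_i < v, and 0 afterwards. No gap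
   straddles v, which is itself in the list. *)
rewrite (telescope_sumr_eq (fun i => Num.min (nth 0 s1 i) v)) //.
  by rewrite last first (min_r (ltW v1)) (min_l v0) subr0.
move=> i /andP[_ si]; have [lt_iv|le_vi] := ltP (nth 0 s1 i) v.
  have im : (i < m)%N.
    rewrite ltnNge; apply/negP => mi.
    have : nth 0 s1 m <= nth 0 s1 i by rewrite homo // mi ltnW.
    by rewrite s1m leNgt lt_iv.
  rewrite mulr1 min_l //.
  by rewrite -s1m homo // im ltnW.
rewrite mulr0 min_r ?subrr //.
by apply: (le_trans le_vi); rewrite homo // leqnSn.
Qed.

(** x - t lies strictly between floor(x) - 1 and floor(x) + 1, and exceeds floor(x) exactly when t
    is below the fractional part. *)
Lemma ceil_threshold (R : realType) (x t : R) : 0 <= t < 1 ->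
  Num.ceil (x - t) = Num.floor x + (t < x - (Num.floor x)%:~R)%R.
Proof.
move=> /andP[t0 t1]; apply: ceil_def; have /andP[fx xf] := floor_itv x.
rewrite rmorphD in xf; rewrite rmorphB !rmorphD.
by case: (ltP t) => h /=; lra.
Qed.

(** All fractional parts are decomposed at once: weights and shifts do not depend on [j], so each
    index [i] rounds a whole sequence. *)
Lemma ceil_decomposition (R : realType) (n : nat) (g : nat -> R) :
  exists (k : nat) (a t : 'I_k -> R),
    [/\ forall i, 0 <= a i, \sum_i a i = 1, forall i, 0 <= t i < 1
      & forall j, (j < n)%N -> g j = \sum_i a i * (Num.ceil (g j - t i))%:~R].
Proof.
pose fr j := g j - (Num.floor (g j))%:~R.
have [|k [a [t [a0 a1 t01 frE]]]] := @threshold_decomposition R (mkseq fr n).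
  move=> _ /mapP[j _ ->]; have /andP[] := floor_itv (g j).
  by rewrite rmorphD /fr /=; lra.
exists k, a, t; split=> // j jn.
under eq_bigr do rewrite ceil_threshold // rmorphD mulrDr /=.
rewrite big_split /= -mulr_suml a1 mul1r.
under [X in _ + X]eq_bigr do rewrite -pmulrn.
rewrite -frE ?subrKC //.
by apply/mapP; exists j; rewrite ?mem_iota.
Qed.

(** * Partial sums and vectors of paths *)

Section PartialSums.
Variables (R : realType) (n : nat).
Implicit Types (x y : 'rV[R]_n) (k : nat).

Definition psum x k : R := \sum_(j < n | (j < k)%N) x 0 j.

Lemma psum0 x : psum x 0 = 0.
Proof. exact: big_pred0. Qed.

Lemma psumS x (i : 'I_n) : psum x i.+1 = psum x i + x 0 i.
Proof.
rewrite /psum (bigD1 i) //= addrC; congr (_ + _); apply: eq_bigl => j.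
by rewrite ltnS ltn_neqAle andbC.
Qed.

Lemma psum_inj x y : (forall k, (k <= n)%N -> psum x k = psum y k) -> x = y.
Proof.
move=> xy; apply/rowP => i; apply: (addrI (psum x i)).
by rewrite -psumS !xy ?(ltnW (ltn_ord i)) // psumS.
Qed.

Lemma psum_increments (g : nat -> R) k : g 0%N = 0 -> (k <= n)%N ->
  psum (\row_j (g j.+1 - g j)) k = g k.
Proof.
move=> g0; elim: k => [|k IH] kn; first by rewrite psum0 g0.
rewrite -[k]/(nat_of_ord (Ordinal kn)) psumS IH ?(ltnW kn) //.
by rewrite mxE subrKC.
Qed.

Lemma psumZ (a : R) x k : psum (a *: x) k = a * psum x k.
Proof. by rewrite /psum mulr_sumr; apply: eq_bigr => j _; rewrite mxE. Qed.

Lemma psum_comb (p : nat) (a : 'I_p -> R) (v : 'I_p -> 'rV[R]_n) k :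
  psum (\sum_i a i *: v i) k = \sum_i a i * psum (v i) k.
Proof.
rewrite /psum; under eq_bigr do rewrite summxE.
rewrite exchange_big; apply: eq_bigr => i _ /=.
by rewrite mulr_sumr; apply: eq_bigr => j _; rewrite mxE.
Qed.

Lemma psum_int x k : int_points R n x -> psum x k \is a Num.int.
Proof. by move=> xint; apply: rpred_sum => j _; apply: xint. Qed.

Definition path_vector (P : n.-tuple bool) : 'rV[R]_n := \row_j (tnth P j)%:R.

Lemma psum_path P k : (k <= n)%N -> psum (path_vector P) k = (height P k)%:R.
Proof.
elim: k => [|k IH] kn; first by rewrite psum0 height0.
rewrite -[k]/(nat_of_ord (Ordinal kn)) psumS IH ?(ltnW kn) //.
by rewrite heightS natrD mxE.
Qed.

(** Turns the upper bounds in the definition of Q_M into differences of heights. *)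
Lemma sum_steps (P Q : n.-tuple bool) k : (k <= n)%N ->
  \sum_(j < k) ((nth false P j)%:R - (nth false Q j)%:R) =
  (height P k)%:R - (height Q k)%:R :> R.
Proof.
elim: k => [|k IH] kn; first by rewrite big_ord0 !height0 subrr.
rewrite big_ord_recr /= IH ?(ltnW kn) //.
rewrite -[k.+1]/((Ordinal kn).+1) !heightS !natrD !(tnth_nth false) /=; lra.
Qed.

End PartialSums.

(** * The change of coordinates between the two polytopes *)

(** q lists heights relative to [L] after 1, ..., n - 1 steps. The value 0 after 0 and n steps
    records that all paths share their endpoints. *)
Definition extend0 (R : realType) (n : nat) (q : 'rV[R]_n) (k : nat) : R :=
  if k is k'.+1 then if insub k' is Some i then q 0 i else 0 else 0.
Arguments extend0 : simpl never.

Section Coordinates.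
Variables (R : realType) (n : nat) (L : n.-tuple bool).
Implicit Types (c : R) (x : 'rV[R]_n) (q : 'rV[R]_n.-1).

(* [c] is the dilation factor: [relative_heights c] and [from_heights c] are
   mutually inverse between the [c]-dilates of the two polytopes. *)
Definition relative_heights c x : 'rV[R]_n.-1 :=
  \row_i (psum x i.+1 - c * (height L i.+1)%:R).

Definition from_heights c q : 'rV[R]_n :=
  \row_j (extend0 q j.+1 + c * (height L j.+1)%:R
          - (extend0 q j + c * (height L j)%:R)).

Lemma extend0_ord q (i : 'I_n.-1) : extend0 q i.+1 = q 0 i.
Proof. by rewrite /extend0 valK. Qed.

Lemma extend0_full q : extend0 q n = 0.
Proof. by rewrite /extend0; move: q; case: n => [|k] q //=; rewrite insubF //= ltnn. Qed.

Lemma psum_from_heights c q k : (k <= n)%N ->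
  psum (from_heights c q) k = extend0 q k + c * (height L k)%:R.
Proof.
move=> kn; apply: (psum_increments (g := fun k => _ + c * (height L k)%:R)) => //.
by rewrite height0 mulr0 addr0.
Qed.

Lemma ltn_ord_pred (i : 'I_n.-1) : (i.+1 < n)%N.
Proof. by have := ltn_ord i; lia. Qed.

Lemma from_heightsK c q : relative_heights c (from_heights c q) = q.
Proof.
apply/rowP => i; rewrite mxE psum_from_heights ?(ltnW (ltn_ord_pred i)) //.
by rewrite extend0_ord addrK.
Qed.

(** [relative_heights] forgets the last partial sum; the hypothesis prescribes it. *)
Lemma relative_heightsK c x : psum x n = c * (height L n)%:R ->
  from_heights c (relative_heights c x) = x.
Proof.
move=> xn; apply: psum_inj => k kn; rewrite psum_from_heights //.
case: k kn => [|k] kn; first by rewrite height0 psum0 mulr0 addr0.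
have [kn1|] := ltnP k n.-1.
  by rewrite -[k]/(nat_of_ord (Ordinal kn1)) extend0_ord mxE subrK.
move=> nk; have kE : k.+1 = n.
  by apply: anti_leq; rewrite kn (leq_trans (leqSpred n)).
by rewrite kE extend0_full add0r xn.
Qed.

Lemma relative_heightsZ c x :
  relative_heights c (c *: x) = c *: relative_heights 1 x.
Proof. by apply/rowP => i; rewrite !mxE psumZ mul1r mulrBr. Qed.

Lemma extend0Z c q k : extend0 (c *: q) k = c * extend0 q k.
Proof.
by rewrite /extend0; case: k => [|k]; rewrite ?mulr0 //; case: insub => [i|]; rewrite ?mxE ?mulr0.
Qed.

Lemma from_heightsZ c q : from_heights c (c *: q) = c *: from_heights 1 q.
Proof. by apply/rowP => i; rewrite !mxE !extend0Z !mul1r; lra. Qed.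

(** With the converse below, this matches the lattice points of the dilates: partial sums and
    increments preserve integrality, and the translation is integral for integer t. *)
Lemma relative_heights_int (t : nat) x :
  int_points R n x -> int_points R n.-1 (relative_heights t%:R x).
Proof.
by move=> xint i; rewrite mxE rpredB ?psum_int // rpredM // rpred_nat.
Qed.

Lemma extend0_int q k : int_points R n.-1 q -> extend0 q k \is a Num.int.
Proof. by move=> qint; rewrite /extend0; case: k => [|k] //; case: insub => [i|]. Qed.

Lemma from_heights_int (t : nat) q :
  int_points R n.-1 q -> int_points R n (from_heights t%:R q).
Proof.
by move=> qint i; rewrite mxE !(rpredB, rpredD, rpredM) ?extend0_int ?rpred_nat.
Qed.

Lemma affine_relative_heights : affine_map (relative_heights 1).
Proof.
exists (\matrix_(j, i) (j < i.+1)%N%:R), (\row_i - (height L i.+1)%:R) => x.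
apply/rowP => i; rewrite !mxE mul1r; congr (_ + _).
rewrite /psum big_mkcond; apply: eq_bigr => j _; rewrite mxE.
by case: ifP => _; rewrite ?mulr1 ?mulr0.
Qed.

End Coordinates.

(** * The polytopes P_M and Q_M *)

Section Polytopes.
Variables (R : realType) (r m : nat) (U L : (r + m).-tuple bool).
Hypotheses (hU : lattice_path U) (hL : lattice_path L).

Let n : nat := (r + m)%N.

Definition path_between (P : n.-tuple bool) : bool :=
  [&& lattice_path P, never_above P U & never_above L P].

Lemma matroid_polytopeE :
  matroid_polytope R (lpm_bases U L) =
  conv_hull [set x | exists2 P, path_between P & x = path_vector R P].
Proof.
have vecE (P : n.-tuple bool) :
    \sum_(i in [set i | tnth P i]%SET) delta_mx 0 i = path_vector R P.
  rewrite [RHS]row_sum_delta big_mkcond; apply: eq_bigr => i _.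
  by rewrite inE mxE; case: (tnth P i); rewrite ?scale1r ?scale0r.
congr conv_hull; apply/seteqP; split=> x /=.
  move=> [B /lpm_basesP[P [h1 h2 h3] ->] ->].
  by exists P; [apply/and3P | rewrite vecE].
move=> [P /and3P[h1 h2 h3] ->]; exists [set i | tnth P i]%SET; last first.
  by rewrite vecE.
by apply/lpm_basesP; exists P.
Qed.

Lemma path_between_bounds (P : n.-tuple bool) k : path_between P -> (k <= n)%N ->
  (height L k)%:R <= ((height P k)%:R : R) <= (height U k)%:R.
Proof.
move=> /and3P[_ /never_aboveP PU /never_aboveP LP] kn.
by rewrite !ler_nat PU // LP.
Qed.

(** For either bit b, 0 <= (-1)^b z <= 1 means 0 <= z + b <= 1. So the slope conditions say that the
    absolute heights, q plus those of [L], have increments in [0, 1]. *)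
Lemma lpm_polytopeP (q : 'rV[R]_n.-1) :
  lpm_polytope R U L q <->
  (forall i j : 'I_n.-1, j = i.+1 :> nat ->
     0 <= q 0 j - q 0 i + (nth false L j)%:R <= 1) /\
  (forall i : 'I_n.-1,
     0 <= q 0 i <= (height U i.+1)%:R - (height L i.+1)%:R).
Proof.
have slopeE (b : bool) (z : R) :
    (0 <= (-1) ^+ b * z <= 1) = (0 <= z + b%:R <= 1).
  by case: b => /=; apply/idP/idP => /andP[? ?]; apply/andP; split; lra.
by split=> -[h1 h2]; split=> [i j ij|i]; have := h2 i; first [have := h1 i j ij;
  rewrite slopeE | rewrite sum_steps // (ltnW (ltn_ord_pred i))].
Qed.

Lemma lpm_polytope_path (P : n.-tuple bool) : path_between P ->
  lpm_polytope R U L (relative_heights L 1 (path_vector R P)).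
Proof.
move=> PB; apply/lpm_polytopeP; split=> [i j ij|i]; last first.
  have in_n := ltnW (ltn_ord_pred i); rewrite mxE psum_path // mul1r.
  by have := path_between_bounds PB in_n; lra.
have jn := ltn_ord_pred j; rewrite ij in jn.
rewrite !mxE !psum_path ?ij ?(ltnW jn) ?(ltnW (ltnW jn)) //.
rewrite !(heightS_nth _ (ltnW jn)) !natrD.
by case: (nth false P i.+1) => /=; lra.
Qed.

Lemma lpm_polytope_comb (k : nat) (a : 'I_k -> R) (q : 'I_k -> 'rV[R]_n.-1) :
  (forall i, 0 <= a i) -> \sum_i a i = 1 -> (forall i, lpm_polytope R U L (q i)) ->
  lpm_polytope R U L (\sum_i a i *: q i).
Proof.
move=> a0 a1 Qq; apply/lpm_polytopeP.
have entry j : (\sum_i a i *: q i) 0 j = \sum_i a i * q i 0 j.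
  by rewrite summxE; apply: eq_bigr => i _; rewrite mxE.
split=> [i j ij|i].
  pose d := (nth false L j)%:R : R.
  have := @conv_hull_comb_bounds R k a (fun l => q l 0 j - q l 0 i) (- d) (1 - d) a0 a1.
  under eq_bigr do rewrite mulrBr.
  rewrite sumrB -!entry => bnd.
  have : - d <= (\sum_i a i *: q i) 0 j - (\sum_i a i *: q i) 0 i <= 1 - d.
    apply: bnd => l; have [/(_ i j ij) + _] := (lpm_polytopeP (q l)).1 (Qq l).
    by rewrite -/d; lra.
  by rewrite -/d; lra.
rewrite entry; apply: conv_hull_comb_bounds => // l.
by have [_ ] := (lpm_polytopeP (q l)).1 (Qq l).
Qed.

(* Replacing each height by its ceiling after a shift by t in [0, 1) turns a
   fractional path into a lattice path, and averaging over suitable t gives the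
   fractional path back. *)
Lemma fractional_path (g : nat -> R) : g 0%N = 0 ->
  (forall k, (k < n)%N -> 0 <= g k.+1 - g k <= 1) ->
  (forall k, (k <= n)%N -> (height L k)%:R <= g k <= (height U k)%:R) ->
  matroid_polytope R (lpm_bases U L) (\row_j (g j.+1 - g j)).
Proof.
move=> g0 slope bnd; rewrite matroid_polytopeE.
have [k [a [t [a0 a1 t01 gE]]]] := ceil_decomposition n.+1 g.
pose c i j := Num.ceil (g j - t i).
pose P i : n.-tuple bool := [tuple c i j.+1 != c i j | j < n].
have heightP i j : (j <= n)%N -> (height (P i) j)%:Z = c i j.
  elim: j => [|j IH] jn.
    (* The ceiling of -t is 0 for 0 <= t < 1, so every rounded path starts at height 0. *)
    rewrite height0 /c g0; apply/esym/ceil_def.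
    by have := t01 i; rewrite rmorphB /=; lra.
  rewrite (heightS (P i) (Ordinal jn)) tnth_mktuple /= PoszD IH ?(ltnW jn) //.
  (* An increment in [0, 1] raises the ceiling by 0 or 1, so recording whether the ceiling changes
     records its increment. *)
  have le1 : c i j <= c i j.+1.
    by apply: le_ceil; have := slope _ jn; lra.
  have le2 : c i j.+1 <= c i j + 1.
    rewrite ceil_le_int rmorphD /=; have := ceil_ge (g j - t i).
    by have := slope _ jn; rewrite /c; lra.
  by case: eqP => /=; lia.
have PB i : path_between (P i).
  have bounds j : (j <= n)%N ->
      (height L j <= height (P i) j <= height U j)%N.
    move=> jn; rewrite -!lez_nat !heightP //; apply/andP; split.
      (* Since t < 1, the shifted height stays strictly above [height L j] - 1, so its ceiling is at
         least [height L j]. *)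
      have : ((height L j)%:Z - 1)%:~R < (c i j)%:~R :> R.
        apply: lt_le_trans (ceil_ge _); rewrite rmorphB /= -pmulrn.
        by have := t01 i; have := bnd j jn; lra.
      by rewrite ltr_int; lia.
    rewrite ceil_le_int -pmulrn.
    by have := t01 i; have := bnd j jn; lra.
  apply/and3P; split.
  (* Both bounds equal r after n steps. *)
  - rewrite /lattice_path -height_full; have := bounds n (leqnn _).
    by rewrite !height_full (eqP hU) (eqP hL) -eqn_leq eq_sym -height_full.
  - by apply/never_aboveP => j /bounds/andP[].
  - by apply/never_aboveP => j /bounds/andP[].
exists k, a, (fun i => path_vector R (P i)); split=> // [i|]; first by exists (P i).
apply: psum_inj => j jn; rewrite psum_increments // psum_comb gE //.
by apply: eq_bigr => i _; rewrite psum_path // pmulrn heightP.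
Qed.

(** The slope conditions of Q_M cover the inner steps only. For the first and last step the
    increment bounds follow from the box conditions, because [L] and [U] have common endpoints and
    steps 0 or 1. *)
Lemma from_heights_mem (q : 'rV[R]_n.-1) : never_above L U ->
  lpm_polytope R U L q ->
  matroid_polytope R (lpm_bases U L) (from_heights L 1 q).
Proof.
move=> /never_aboveP LU /lpm_polytopeP[slope box].
have ext_box k : (k <= n)%N ->
    0 <= extend0 q k <= (height U k)%:R - (height L k)%:R.
  case: k => [|k] kn; first by rewrite !height0 subrr lexx.
  have [kn1|nk] := ltnP k n.-1; first by
    have := box (Ordinal kn1); rewrite -extend0_ord.
  have -> : k.+1 = n by apply: anti_leq; rewrite kn (leq_trans (leqSpred n)).
  by rewrite extend0_full subr_ge0 ler_nat LU ?lexx.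
apply: (fractional_path (g := fun k => _ + 1 * (height L k)%:R)) => [|k kn|k kn].
- by rewrite height0 mulr0 addr0.
- have box_k := ext_box k (ltnW kn); have box_k1 := ext_box k.+1 kn.
  have [k1n|nk] := ltnP k.+1 n; last first.
    have k1n : k.+1 = n by apply: anti_leq; rewrite kn.
    have UL_n : height U k.+1 = height L k.+1.
      by rewrite k1n !height_full (eqP hU) (eqP hL).
    have -> : extend0 q k.+1 = 0 by rewrite k1n extend0_full.
    move: UL_n box_k; rewrite !heightS_nth // => UL_n.
    have := congr1 (GRing.natmul (1 : R)) UL_n; rewrite !natrD.
    by move: (nth false U k) (nth false L k) => [] [] /=; lra.
  case: k kn k1n box_k box_k1 => [|k] kn k1n box_k box_k1.
    have := height_leq U 1; rewrite -(ler_nat R) height0 mulr0 /(extend0 q 0).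
    have := ler0n R (height L 1); lra.
  have jn : (k.+1 < n.-1)%N by lia.
  have := slope (Ordinal (ltnW jn)) (Ordinal jn) (erefl _).
  rewrite -!extend0_ord (heightS_nth L kn) natrD /=; lra.
- by have := ext_box k kn; lra.
Qed.

(** Each condition bounds one coordinate or a difference of two, and such conditions survive
    componentwise maxima and minima. *)
Lemma lpm_polytope_distributive : distributive (lpm_polytope R U L).
Proof.
move=> x y /lpm_polytopeP[xs xb] /lpm_polytopeP[ys yb].
split; apply/lpm_polytopeP; split=> [i j ij|i]; rewrite !mxE.
- have := xs i j ij; have := ys i j ij.
  by case: (leP (x 0 j) (y 0 j)) => ?; case: (leP (x 0 i) (y 0 i)) => ?; lra.
- by have := xb i; have := yb i; case: (leP (x 0 i) (y 0 i)) => ?; lra.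
- have := xs i j ij; have := ys i j ij.
  by case: (leP (x 0 j) (y 0 j)) => ?; case: (leP (x 0 i) (y 0 i)) => ?; lra.
- by have := xb i; have := yb i; case: (leP (x 0 i) (y 0 i)) => ?; lra.
Qed.

(* The interior point is the average of U and L, tilted slightly towards the
   line of slope 1/2 to make the slope constraints strict. *)
Lemma lpm_polytope_full_dimensional :
  (forall k, (0 < k < n)%N -> (height L k < height U k)%N) ->
  full_dimensional (lpm_polytope R U L).
Proof.
(* The tilt leaves slack at least e / 2 in every slope condition, and e (n + 1) = 1/2 keeps tilt and
   perturbation within the margin 1/2 that [apart] gives in the box conditions. *)
move=> apart; pose e : R := 2^-1 / n.+1%:R.
have n1 : 0 < n.+1%:R :> R by rewrite ltr0n.
have e0 : 0 < e by rewrite divr_gt0 // invr_gt0 ltr0n.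
have eS : e * n.+1%:R = 2^-1 by rewrite divfK // gt_eqF.
pose p : 'rV[R]_n.-1 := \row_i (((height U i.+1)%:R - (height L i.+1)%:R) / 2
  + e / 2 * (i.+1%:R - (height L i.+1)%:R - (height U i.+1)%:R)).
have near_p (z : 'rV[R]_n.-1) :
    (forall i, 0 <= z 0 i <= e / 2) -> lpm_polytope R U L (p + z).
  move=> z0e; apply/lpm_polytopeP; split=> [i j ij|i]; rewrite !mxE.
    have := z0e i; have := z0e j; rewrite ij.
    have in_n := ltn_ord_pred i.
    rewrite !(heightS_nth _ in_n) -(natr1 i.+1) !natrD.
    have e1 : e <= 2^-1.
      by rewrite -eS ler_peMr ?(ltW e0) // ler1n.
    by case: (nth false U i.+1) (nth false L i.+1) => [] [] /=; lra.
  have in_n := ltn_ord_pred i.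
  have := apart i.+1 in_n; rewrite -(ler_nat R) -natr1.
  have scaled (a b : nat) : (a <= b)%N -> e * a%:R <= e * b%:R.
    by move=> ab; rewrite ler_pM2l // ler_nat.
  have := scaled _ _ (height_leq L i.+1); have := scaled _ _ (height_leq U i.+1).
  have := scaled _ _ (leqW (ltnW in_n)); have := scaled _ _ (leq0n (height L i.+1)).
  have := scaled _ _ (leq0n (height U i.+1)); have := scaled _ _ (ltn0Sn n).
  have := scaled _ _ (leq0n i.+1).
  rewrite eS; have := z0e i.
  move: (z 0 i) (height U i.+1)%:R (height L i.+1)%:R (i.+1%:R) => zi u l k.
  lra.
apply: (@affine_hull_simplex R n.-1 _ p (e / 2)).
- by rewrite mulf_neq0 ?gt_eqF // invr_gt0 ltr0n.
- by rewrite -[p]addr0; apply: near_p => i; rewrite mxE; lra.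
- move=> i; apply: near_p => j; rewrite !mxE /=.
  by case: (j == i); rewrite /= ?mulr1 ?mulr0; lra.
Qed.

Lemma psum_comb_const (k : nat) (a : 'I_k -> R)
    (v : 'I_k -> 'rV[R]_n) (s : R) :
  \sum_i a i = 1 -> (forall i, psum (v i) n = s) ->
  psum (\sum_i a i *: v i) n = s.
Proof.
move=> a1 vs; rewrite psum_comb; under eq_bigr do rewrite vs.
by rewrite -mulr_suml a1 mul1r.
Qed.

(** All bases have r elements; r is written [height L n] to fit [relative_heightsK]. *)
Lemma psum_matroid_polytope (x : 'rV[R]_n) :
  matroid_polytope R (lpm_bases U L) x -> psum x n = (height L n)%:R.
Proof.
rewrite matroid_polytopeE => -[k [a [v [PB _ a1 ->]]]].
apply: psum_comb_const a1 _ => i; have [P /and3P[P_r _ _] ->] := PB i.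
by rewrite psum_path // !height_full (eqP hL) (eqP P_r).
Qed.

Lemma psum_affine_hull (x : 'rV[R]_n) :
  affine_hull (matroid_polytope R (lpm_bases U L)) x ->
  psum x n = (height L n)%:R.
Proof.
move=> [k [a [v [PM a1 ->]]]]; apply: psum_comb_const a1 _ => i.
exact: psum_matroid_polytope.
Qed.

Lemma image_matroid_polytope : never_above L U ->
  relative_heights L 1 @` matroid_polytope R (lpm_bases U L) =
  lpm_polytope R U L.
Proof.
move=> LU; apply/seteqP; split=> [_ [x + <-]|q Qq].
  rewrite matroid_polytopeE => -[k [a [v [PB a0 a1 ->]]]].
  rewrite (affine_map_comb _ (affine_relative_heights R L)) //.
  apply: lpm_polytope_comb => // i; have [P ? ->] := PB i.
  exact: lpm_polytope_path.
exists (from_heights L 1 q); first exact: from_heights_mem.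
exact: from_heightsK.
Qed.

(** As a hull of finitely many integer points, Q_M is a polytope with integral vertices. *)
Lemma lpm_polytopeE : never_above L U ->
  lpm_polytope R U L = conv_hull [set q | exists2 P, path_between P &
    q = relative_heights L 1 (path_vector R P)].
Proof.
move=> LU; rewrite -image_matroid_polytope // matroid_polytopeE.
rewrite conv_hull_image; last exact: affine_relative_heights.
congr conv_hull; apply/seteqP; split=> [_ [_ [P PB ->] <-]|_ [P PB ->]].
  by exists P.
by exists (path_vector R P) => //; exists P.
Qed.

(** Injectivity comes from the fixed coordinate sum on the affine hull of P_M. For surjectivity, the
    points of an affine combination are lifted one by one with the same weights. *)
Lemma affine_bij_lpm_polytope : never_above L U ->
  affine_bij_onto (matroid_polytope R (lpm_bases U L)) (lpm_polytope R U L).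
Proof.
move=> LU; have aff := affine_relative_heights R L.
have imPM := image_matroid_polytope LU.
exists (relative_heights L 1); split=> //; split=> [|x y|].
- move=> _ [k [a [v [PM a1 ->]]]]; exists k, a, (relative_heights L 1 \o v).
  split=> // [i|]; first by rewrite -imPM; exists (v i).
  exact: affine_map_comb.
- rewrite !inE => /psum_affine_hull xn /psum_affine_hull yn xy.
  by rewrite -(@relative_heightsK R n L 1 x) ?xy ?relative_heightsK ?mul1r.
- move=> _ [k [a [v [QM a1 ->]]]].
  exists (\sum_i a i *: from_heights L 1 (v i)).
    exists k, a, (from_heights L 1 \o v); split=> // i.
    exact: from_heights_mem.
  by rewrite affine_map_comb //; under eq_bigr do rewrite from_heightsK.
Qed.

Lemma lpm_polytope_integer : never_above L U ->
  integer_polytope (lpm_polytope R U L).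
Proof.
move=> LU; rewrite lpm_polytopeE //; split; first exact: polytope_conv_hull.
move=> _ /vertex_conv_hull[P _ ->].
apply: (@relative_heights_int R n L 1%N) => i.
by rewrite mxE rpred_nat.
Qed.

(** Dilation by t also multiplies the translation by t, hence the factor [t%:R] in the two inverse
    maps. *)
Lemma ehrhart_lpm_polytope (t : nat) : never_above L U ->
  ehrhart (matroid_polytope R (lpm_bases U L)) t = ehrhart (lpm_polytope R U L) t.
Proof.
move=> LU; apply: (card_fset_set_bij (f := relative_heights L t%:R)
  (g := from_heights L t%:R)) => [_ [[x PMx <-] int_x]|_ [[q Qq <-] int_q]].
  split; last first.
    by rewrite relative_heightsK // psumZ psum_matroid_polytope.
  split; last exact: relative_heights_int.
  exists (relative_heights L 1 x); last by rewrite relative_heightsZ.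
  by rewrite -image_matroid_polytope //; exists x.
split; last exact: from_heightsK.
split; last exact: from_heights_int.
exists (from_heights L 1 q); last by rewrite from_heightsZ.
exact: from_heights_mem.
Qed.

End Polytopes.

Theorem theorem4p1 (R : realType) (r m : nat) (U L : (r + m).-tuple bool)
    (hU : lattice_path U) (hL : lattice_path L) (hLU : never_above L U)
    (hM : connected_matroid (lpm_bases U L)) :
  let PM : set 'rV[R]_(r + m) := matroid_polytope R (lpm_bases U L) in
  let QM : set 'rV[R]_((r + m).-1) := lpm_polytope R U L in
  [/\ affine_bij_onto PM QM,
      full_dimensional QM,
      distributive QM,
      integer_polytope QM
    & forall t : nat, ehrhart PM t = ehrhart QM t].
Proof.
split.
- exact: affine_bij_lpm_polytope.
- by apply: lpm_polytope_full_dimensional; apply: connected_lpm_apart.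
- exact: lpm_polytope_distributive.
- exact: lpm_polytope_integer.
- by move=> t; apply: ehrhart_lpm_polytope.
Qed.
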